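(* Let $Q\in\mathbb R^{n\times n}$ be a symmetric irreducible loopy Laplacian, let $\alpha=\{1,\dots,|\alpha|\}$ with $2\le|\alpha|<n$ be the boundary nodes, let $Q_{\mathrm{red}}=Q/Q(\alpha,\alpha)=Q[\alpha,\alpha]-Q[\alpha,\alpha)Q(\alpha,\alpha)^{-1}Q(\alpha,\alpha]$ and $Q_{\mathrm{ac}}=-Q[\alpha,\alpha)Q(\alpha,\alpha)^{-1}\in\mathbb R^{|\alpha|\times(n-|\alpha|)}$. For distinct $i,j\in\{1,\dots,n-|\alpha|\}$ and $\Delta\in\mathbb R$ let $W=\Delta(e_{i+|\alpha|}-e_{j+|\alpha|})(e_{i+|\alpha|}-e_{j+|\alpha|})^T\in\mathbb R^{n\times n}$, and assume $\tilde Q=Q+W$ is again an irreducible loopy Laplacian. Then: 1) With $R_{\mathrm{int}}[i,j]=(e_i-e_j)^TQ(\alpha,\alpha)^{-1}(e_i-e_j)\ge0$ (here $e_i,e_j\in\mathbb R^{n-|\alpha|}$), $$\tilde Q/\tilde Q(\alpha,\alpha)=Q_{\mathrm{red}}+\frac{Q_{\mathrm{ac}}(e_i-e_j)\,\Delta\,(e_i-e_j)^TQ_{\mathrm{ac}}^T}{1+\Delta\cdot R_{\mathrm{int}}[i,j]}.$$ 2) Let $R$ and $\tilde R$ be the effective resistance matrices of $Q$ and $\tilde Q$, i.e. $R_{k\ell}=(e_k-e_\ell)^TQ^{\dagger}(e_k-e_\ell)$ and $\tilde R_{k\ell}=(e_k-e_\ell)^T\tilde Q^{\dagger}(e_k-e_\ell)$.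 Then for all $k,\ell\in\{1,\dots,n\}$, $$\tilde R_{k\ell}=R_{k\ell}-\frac{\Delta}{1+\Delta\cdot R_{i+|\alpha|,\,j+|\alpha|}}\big\|(e_k-e_\ell)^TQ^{\dagger}(e_{i+|\alpha|}-e_{j+|\alpha|})\big\|_2^2.$$ In particular, if $\Delta>0$ then $\tilde R_{k\ell}\le R_{k\ell}$, and if $\Delta<0$ then $\tilde R_{k\ell}\ge R_{k\ell}$.
   Context: A loopy Laplacian is built from a symmetric matrix $A\in\mathbb R^{n\times n}$ with nonnegative entries (off-diagonal: edge weights; diagonal: self-loop weights): $Q_{ij}=-A_{ij}$ for $i\ne j$, $Q_{ii}=\sum_{j\ne i}A_{ij}+A_{ii}$; it is irreducible if the graph with edges $\{i,j\}$ ($i\ne j$, $A_{ij}>0$) is connected. $^{\dagger}$ is the Moore–Penrose pseudoinverse. The first $|\alpha|$ indices are boundary nodes, the rest interior nodes. Block notation: $Q[\alpha,\alpha]$ rows/columns in $\alpha$; $Q(\alpha,\alpha)$ rows/columns in the complement of $\alpha$ (invertible for irreducible $Q$); $Q[\alpha,\alpha)$ rows in $\alpha$, columns in the complement; $Q(\alpha,\alpha]=Q[\alpha,\alpha)^T$. For $\tilde Q$, $\tilde Q/\tilde Q(\alpha,\alpha)$ is defined analogously. *)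

(* Defs.v *)
From mathcomp Require Import all_boot all_order all_algebra.
From mathcomp Require Import reals.

Set Implicit Arguments.
Unset Strict Implicit.
Unset Printing Implicit Defensive.

Import Order.TTheory GRing.Theory Num.Theory.
Local Open Scope ring_scope.

Section MoorePenrose.
Variable R : realFieldType.

(* The four Penrose equations, for real matrices. *)
Definition penrose m n (A : 'M[R]_(m, n)) (X : 'M[R]_(n, m)) : bool :=
  [&& A *m X *m A == A, X *m A *m X == X,
      (A *m X)^T == A *m X & (X *m A)^T == X *m A].

Lemma dotmx_eq0 n (x : 'rV[R]_n) : x *m x^T = 0 -> x = 0.
Proof.
move=> /matrixP/(_ 0 0); rewrite !mxE => h.
have /psumr_eq0P : \sum_(j < n) x 0 j ^+ 2 = 0.
  by rewrite -[RHS]h; apply: eq_bigr => k _; rewrite mxE expr2.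
move=> /(_ (fun i _ => sqr_ge0 _)) h0.
apply/rowP => k; rewrite mxE; apply/eqP.
by rewrite -sqrf_eq0; apply/eqP/h0.
Qed.

Lemma gram_unit m n (F : 'M[R]_(m, n)) : row_free F -> F *m F^T \in unitmx.
Proof.
move=> freeF; rewrite -row_free_unit; apply/inj_row_free => v.
rewrite mulmxA => vFF0.
have /dotmx_eq0 vF0 : (v *m F) *m (v *m F)^T = 0.
  by rewrite trmx_mul mulmxA vFF0 mul0mx.
by apply: (row_free_inj freeF); rewrite mul0mx.
Qed.

Lemma penrose_exists m n (A : 'M[R]_(m, n)) : exists X, penrose A X.
Proof.
have [r [C [F [AE uC uF]]]] : exists r (C : 'M[R]_(m, r)) (F : 'M[R]_(r, n)),
    [/\ C *m F = A, C^T *m C \in unitmx & F *m F^T \in unitmx].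
  exists (\rank A), (col_base A), (row_base A); split.
  - exact: mulmx_base.
  - rewrite -[X in _ *m X]trmxK; apply: gram_unit.
    by rewrite /row_free mxrank_tr; apply: col_base_full.
  - exact/gram_unit/row_base_free.
pose P := invmx (F *m F^T); pose S := invmx (C^T *m C).
have PT : P^T = P by rewrite /P trmx_inv trmx_mul trmxK.
have ST : S^T = S by rewrite /S trmx_inv trmx_mul trmxK.
pose X := F^T *m P *m S *m C^T.
have AX : A *m X = C *m S *m C^T.
  by rewrite -AE /X !mulmxA -(mulmxA C F) -(mulmxA C _ P) mulmxV // mulmx1.
have XA : X *m A = F^T *m P *m F.
  by rewrite -AE /X !mulmxA -(mulmxA _ C^T C) -(mulmxA _ S) mulVmx // mulmx1.
exists X; apply/and4P; split; apply/eqP.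
- by rewrite AX -AE !mulmxA -(mulmxA _ C^T C) -(mulmxA _ S) mulVmx // mulmx1.
- rewrite XA /X !mulmxA -(mulmxA _ F F^T) -(mulmxA _ _ P) mulmxV // mulmx1.
  by [].
- by rewrite AX !trmx_mul trmxK ST mulmxA.
- by rewrite XA !trmx_mul trmxK PT mulmxA.
Qed.

Definition pinvmp m n (A : 'M[R]_(m, n)) : 'M[R]_(n, m) :=
  xchoose (penrose_exists A).

Lemma pinvmpP m n (A : 'M[R]_(m, n)) : penrose A (pinvmp A).
Proof. exact: xchooseP. Qed.

Lemma penrose_uniq m n (A : 'M[R]_(m, n)) (X Y : 'M[R]_(n, m)) :
  penrose A X -> penrose A Y -> X = Y.
Proof.
move=> /and4P[/eqP x1 /eqP x2 /eqP x3 /eqP x4].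
move=> /and4P[/eqP y1 /eqP y2 /eqP y3 /eqP y4].
have AXY : A *m X = A *m Y.
  rewrite -x3 -[in LHS]y1 -!mulmxA (mulmxA A Y) trmx_mul x3 y3 !mulmxA x1.
  by [].
have XYA : X *m A = Y *m A.
  by rewrite -x4 -[in LHS]y1 !mulmxA -(mulmxA _ Y A) trmx_mul x4 y4 -!mulmxA
             (mulmxA A) x1.
by rewrite -x2 -mulmxA AXY mulmxA XYA y2.
Qed.

Lemma pinvmp_eq m n (A : 'M[R]_(m, n)) (X : 'M[R]_(n, m)) :
  penrose A X -> pinvmp A = X.
Proof. exact/penrose_uniq/pinvmpP. Qed.

End MoorePenrose.

Section Kron.
Variable R : realType.

Definition basis_vec n (k : 'I_n) : 'cV[R]_n := delta_mx k 0.

Definition diff_vec n (k l : 'I_n) : 'cV[R]_n := basis_vec k - basis_vec l.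

Definition l2norm m (v : 'cV[R]_m) : R := Num.sqrt (\sum_i v i 0 ^+ 2).

Definition loopy_laplacian n (A : 'M[R]_n) : 'M[R]_n :=
  \matrix_(i, j) (if i == j then \sum_(k | k != i) A i k + A i i else - A i j).

Definition adj n (A : 'M[R]_n) : rel 'I_n :=
  fun i j => (i != j) && (0 < A i j).

(* [A] is determined by [Q], so the graph of [Q] is unambiguous. *)
Definition irreducible_loopy_laplacian n (Q : 'M[R]_n) : Prop :=
  exists A : 'M[R]_n,
    [/\ A^T = A, forall i j, 0 <= A i j, Q = loopy_laplacian A
      & forall i j, connect (adj A) i j].

Lemma loopy_quad n (A : 'M[R]_n) (x : 'I_n -> R) : A^T = A ->
  2 * (\sum_i \sum_k x i * loopy_laplacian A i k * x k) =
  2 * (\sum_i A i i * x i ^+ 2) + \sum_i \sum_k A i k * (x i - x k) ^+ 2.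
Proof.
move=> AT.
pose S := \sum_i \sum_k A i k * (x i * (x i - x k)).
have -> : \sum_i \sum_k x i * loopy_laplacian A i k * x k =
          \sum_i A i i * x i ^+ 2 + S.
  rewrite /S -big_split; apply: eq_bigr => i _ /=.
  rewrite (bigD1 i) // [in RHS](bigD1 i) //= !mxE eqxx subrr !mulr0 add0r.
  rewrite mulrDr mulrDl addrAC [LHS]addrC; congr (_ + _).
    by rewrite mulrAC -expr2 mulrC.
  rewrite mulr_sumr mulr_suml -big_split; apply: eq_bigr => k ki /=.
  rewrite mxE eq_sym (negPf ki) mulrBr mulrBr mulrN mulNr.
  by rewrite -mulrA [x i * (A i k * x i)]mulrCA -mulrA [x i * (A i k * x k)]mulrCA.
rewrite mulrDr; congr (_ + _); rewrite mulr_natl mulr2n.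
have {2}-> : S = \sum_i \sum_k A i k * (x k * (x k - x i)).
  rewrite /S exchange_big; apply: eq_bigr => i _; apply: eq_bigr => k _ /=.
  by rewrite -{1}AT mxE.
rewrite /S -big_split; apply: eq_bigr => i _ /=.
rewrite -big_split; apply: eq_bigr => k _ /=.
rewrite -mulrDr; congr (_ * _).
by rewrite -[x k - x i]opprB mulrN -mulrBl expr2.
Qed.

Lemma interior_unitmx a b (Q : 'M[R]_(a + b)) : (0 < a)%N ->
  irreducible_loopy_laplacian Q -> drsubmx Q \in unitmx.
Proof.
move=> a0 [A [AT A0 QE conn]].
rewrite -row_free_unit; apply/inj_row_free => y yQ.
pose x k : R := row_mx (0 : 'rV_a) y 0 k.
have q0 : \sum_i \sum_k x i * Q i k * x k = 0.
  have : (row_mx 0 y *m Q *m (row_mx 0 y)^T) 0 0 = 0 :> R.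
    rewrite -[Q]submxK mul_row_block !mul0mx !add0r yQ tr_row_mx.
    by rewrite mul_row_col trmx0 mulmx0 mul0mx addr0 mxE.
  rewrite mxE => q0; rewrite -[RHS]q0 exchange_big; apply: eq_bigr => k _.
  rewrite [X in _ = X * _]mxE [X in _ = _ * X]mxE mulr_suml.
  by apply: eq_bigr.
have := loopy_quad x AT; rewrite -QE q0 mulr0 => /esym/eqP.
have D0 i : 0 <= \sum_k A i k * (x i - x k) ^+ 2.
  by apply: sumr_ge0 => k _; rewrite mulr_ge0 ?sqr_ge0.
rewrite paddr_eq0; first last.
- by apply: sumr_ge0 => i _; apply: D0.
- by rewrite mulr_ge0 // sumr_ge0 // => i _; rewrite mulr_ge0 ?sqr_ge0.
case/andP=> _ /eqP/psumr_eq0P E.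
have step i k : adj A i k -> x i = x k.
  move=> /andP[_ Aik].
  have /psumr_eq0P : \sum_k A i k * (x i - x k) ^+ 2 = 0.
    by apply: E => // ? _; apply: D0.
  move=> /(_ (fun l _ => mulr_ge0 (A0 i l) (sqr_ge0 _)) k isT)/eqP.
  by rewrite mulf_eq0 gt_eqF //= sqrf_eq0 subr_eq0 => /eqP.
have const i k : x i = x k.
  have /connectP[p + ->] := conn i k.
  by elim: p i => //= l p IH i /andP[/step -> /IH].
apply/rowP => k; rewrite [RHS]mxE.
have := const (rshift a k) (lshift b (Ordinal a0)).
by rewrite /x row_mxEr row_mxEl mxE.
Qed.

(* [a] boundary nodes come first, followed by [b] interior nodes, so           *)
(* Q[alpha,alpha], Q[alpha,alpha), Q(alpha,alpha] and Q(alpha,alpha) are       *)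
(* [ulsubmx Q], [ursubmx Q], [dlsubmx Q] and [drsubmx Q].                      *)
Definition kron_red a b (Q : 'M[R]_(a + b)) : 'M[R]_a :=
  ulsubmx Q - ursubmx Q *m invmx (drsubmx Q) *m dlsubmx Q.

Definition accompanying_mx a b (Q : 'M[R]_(a + b)) : 'M[R]_(a, b) :=
  - (ursubmx Q *m invmx (drsubmx Q)).

Definition interior_res a b (Q : 'M[R]_(a + b)) : 'M[R]_b :=
  \matrix_(i, j) ((diff_vec i j)^T *m invmx (drsubmx Q) *m diff_vec i j) 0 0.

Definition eff_res n (Q : 'M[R]_n) : 'M[R]_n :=
  \matrix_(k, l) ((diff_vec k l)^T *m pinvmp Q *m diff_vec k l) 0 0.

Definition perturb a b (i j : 'I_b) (Delta : R) : 'M[R]_(a + b) :=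
  Delta *: (diff_vec (rshift a i) (rshift a j)
            *m (diff_vec (rshift a i) (rshift a j))^T).

End Kron.

(* Main.v *)
Require Import Defs.
From mathcomp Require Import all_boot all_order all_algebra.
From mathcomp Require Import reals.

Set Implicit Arguments.
Unset Strict Implicit.
Unset Printing Implicit Defensive.

Import Order.TTheory GRing.Theory Num.Theory.
Local Open Scope ring_scope.

(** Both formulas are one Sherman-Morrison identity: if [M] is symmetric and [w]
    lies in its range, then the pseudoinverse of [M + D w w^T] is
    [X - D / (1 + D r) X w w^T X] with [X] the pseudoinverse of [M] and
    [r = w^T X w].  The identity [(M + D w w^T) X w = (1 + D r) w] shows that the
    denominator vanishes only if [X w] lies in the kernel of the perturbed
    Laplacian; by connectedness this kernel consists of constant vectors, which
    are orthogonal to [w], so that [r = 0], a contradiction.  Pairing the same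
    identity with [X w] gives [r (1 + D r) >= 0], hence a positive denominator. *)

(** * Pseudoinverse of a symmetric matrix under a rank-one update *)

Section RankOneUpdate.
Variables (R : realFieldType) (n : nat).
Implicit Types (M : 'M[R]_n) (w : 'cV[R]_n).

Lemma pinvmp_sym M : M^T = M -> (pinvmp M)^T = pinvmp M.
Proof.
move=> MT; apply/esym/pinvmp_eq.
have /and4P[/eqP p1 /eqP p2 /eqP p3 /eqP p4] := pinvmpP M.
apply/and4P; split; apply/eqP.
- by move/(congr1 trmx): p1; rewrite !trmx_mul MT mulmxA.
- by move/(congr1 trmx): p2; rewrite !trmx_mul MT mulmxA.
- by rewrite trmx_mul trmxK MT -p4 trmx_mul MT.
- by rewrite trmx_mul trmxK MT -p3 trmx_mul MT.
Qed.

Lemma pinvmp_comm M : M^T = M -> pinvmp M *m M = M *m pinvmp M.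
Proof.
move=> MT; have /and4P[_ _ /eqP p3 _] := pinvmpP M.
by rewrite -[RHS]p3 trmx_mul MT pinvmp_sym.
Qed.

Lemma pinvmp_unit M : M \in unitmx -> pinvmp M = invmx M.
Proof.
move=> uM; apply: pinvmp_eq; rewrite /penrose.
by rewrite mulmxV // mulVmx // !mul1mx trmx1 !eqxx.
Qed.

(** [X] need only act as a right inverse on [w], so the identity serves both [pinvmp] and
    [invmx]. *)
Lemma rank1_update_mul M w (X : 'M[R]_n) (D : R) : M *m X *m w = w ->
  (M + D *: (w *m w^T)) *m (X *m w) = (1 + D * (w^T *m X *m w) 0 0) *: w.
Proof.
move=> Mw; rewrite mulmxDl mulmxA Mw -scalemxAl -mulmxA (mulmxA w^T).
rewrite [w^T *m X *m w in LHS]mx11_scalar mul_mx_scalar scalerA.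
by rewrite scalerDl scale1r.
Qed.

(** The update leaves the range of [M] unchanged, so the candidate has the same products with
    [M + D w w^T], on either side, as [X] has with [M]: the orthogonal projector [M X]. *)
Lemma pinvmp_rank1_update M w (D : R) : M^T = M -> M *m pinvmp M *m w = w ->
    1 + D * (w^T *m pinvmp M *m w) 0 0 != 0 ->
  pinvmp (M + D *: (w *m w^T)) = pinvmp M -
    (D / (1 + D * (w^T *m pinvmp M *m w) 0 0))
      *: (pinvmp M *m w *m (w^T *m pinvmp M)).
Proof.
move=> MT; set X := pinvmp M => Mw; set s := 1 + _ => s0; set Mt := M + _.
set Y := _ - _.
have XT : X^T = X by exact: pinvmp_sym.
have XM : X *m M = M *m X by exact: pinvmp_comm.
have /and4P[/eqP p1 /eqP p2 /eqP p3 _] := pinvmpP M.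
have MtT : Mt^T = Mt.
  by rewrite /Mt linearD linearZ /= trmx_mul trmxK MT.
have YT : Y^T = Y.
  by rewrite /Y linearB linearZ /= !trmx_mul trmxK XT mulmxA.
(* Since [Mt X w = s w], the factor [s] cancels the denominator, and what is left removes the term
   [D w w^T X] of [Mt X]. *)
have MtY : Mt *m Y = M *m X.
  rewrite /Y mulmxBr -scalemxAr (mulmxA Mt) rank1_update_mul // -/X -/s.
  rewrite -scalemxAl scalerA divfK // /Mt mulmxDl -scalemxAl !mulmxA.
  by rewrite addrK.
have YMt : Y *m Mt = M *m X.
  by rewrite -XM -[LHS]trmxK trmx_mul MtT YT MtY trmx_mul MT XT.
apply: pinvmp_eq; apply/and4P; split; apply/eqP.
- by rewrite MtY /Mt mulmxDr p1 -scalemxAr mulmxA Mw.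
- by rewrite YMt /Y mulmxBr -XM p2 -scalemxAr !mulmxA p2.
- by rewrite MtY p3.
- by rewrite YMt p3.
Qed.

Lemma bilin_sym M (u w : 'cV[R]_n) : M^T = M -> w^T *m M *m u = u^T *m M *m w.
Proof.
move=> MT; rewrite [LHS]mx11_scalar -tr_scalar_mx -mx11_scalar.
by rewrite !trmx_mul trmxK MT mulmxA.
Qed.

End RankOneUpdate.

(** * Kernel, range and semidefiniteness of irreducible loopy Laplacians *)

Section IrreducibleLaplacian.
Variable R : realType.

Lemma irreducible_sym n (Q : 'M[R]_n) : irreducible_loopy_laplacian Q -> Q^T = Q.
Proof.
case=> A [AT _ -> _]; apply/matrixP => k l; rewrite !mxE eq_sym.
by case: eqP => [->//|_]; rewrite -{1}AT mxE.
Qed.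

Lemma quad_formE n (M : 'M[R]_n) (x : 'cV[R]_n) :
  (x^T *m M *m x) 0 0 = \sum_i \sum_k x i 0 * M i k * x k 0.
Proof.
rewrite mxE exchange_big; apply: eq_bigr => k _ /=.
by rewrite mxE mulr_suml; apply: eq_bigr => l _; rewrite mxE.
Qed.

Lemma irreducible_psd n (Q : 'M[R]_n) (x : 'cV[R]_n) :
  irreducible_loopy_laplacian Q -> 0 <= (x^T *m Q *m x) 0 0.
Proof.
case=> A [AT A0 -> _]; rewrite quad_formE.
rewrite -(pmulr_rge0 _ (@ltr0Sn R 1)) (loopy_quad (fun k => x k 0) AT).
rewrite addr_ge0 ?mulr_ge0 ?sumr_ge0 // => k _.
  by rewrite mulr_ge0 ?sqr_ge0.
by rewrite sumr_ge0 // => l _; rewrite mulr_ge0 ?sqr_ge0.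
Qed.

(** By [loopy_quad], a zero of the quadratic form kills every edge term, so [z] agrees across each
    edge and hence along paths. *)
Lemma irreducible_ker_const n (Q : 'M[R]_n) (z : 'cV[R]_n) :
  irreducible_loopy_laplacian Q -> Q *m z = 0 -> forall k l, z k 0 = z l 0.
Proof.
move=> [A [AT A0 QE conn]] Qz.
have := loopy_quad (fun k => z k 0) AT.
rewrite -QE -quad_formE -mulmxA Qz mulmx0 mxE mulr0 => /esym/eqP.
have D0 k : 0 <= \sum_l A k l * (z k 0 - z l 0) ^+ 2.
  by apply: sumr_ge0 => l _; rewrite mulr_ge0 ?sqr_ge0.
rewrite paddr_eq0; first last.
- by apply: sumr_ge0 => k _; apply: D0.
- by rewrite mulr_ge0 // sumr_ge0 // => k _; rewrite mulr_ge0 ?sqr_ge0.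
case/andP=> _ /eqP/psumr_eq0P E.
have step k l : adj A k l -> z k 0 = z l 0.
  move=> /andP[_ Akl].
  have /psumr_eq0P : \sum_l A k l * (z k 0 - z l 0) ^+ 2 = 0.
    by apply: E => // ? _; apply: D0.
  move=> /(_ (fun m _ => mulr_ge0 (A0 k m) (sqr_ge0 _)) l isT)/eqP.
  by rewrite mulf_eq0 gt_eqF //= sqrf_eq0 subr_eq0 => /eqP.
move=> k l; have /connectP[s + ->] := conn k l.
by elim: s k => //= m s IH k /andP[/step -> /IH].
Qed.

Lemma diff_vec_trmul n (p q : 'I_n) (z : 'cV[R]_n) :
  (diff_vec R p q)^T *m z = (z p 0 - z q 0)%:M.
Proof.
rewrite /diff_vec /basis_vec linearB mulmxBl /= !trmx_delta -!rowE.
by rewrite [LHS]mx11_scalar !mxE.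
Qed.

Lemma irreducible_ker_diff_vec n (Q : 'M[R]_n) (z : 'cV[R]_n) p q :
  irreducible_loopy_laplacian Q -> Q *m z = 0 -> (diff_vec R p q)^T *m z = 0.
Proof.
move=> hQ Qz; rewrite diff_vec_trmul (irreducible_ker_const hQ Qz p q).
by rewrite subrr raddf0.
Qed.

(** The defect [z = w - Q X w] lies in the kernel of [Q], hence is orthogonal both to [w] and to the
    range of [Q], and so to itself. *)
Lemma diff_vec_range n (Q : 'M[R]_n) p q : irreducible_loopy_laplacian Q ->
  Q *m pinvmp Q *m diff_vec R p q = diff_vec R p q.
Proof.
move=> hQ; set w := diff_vec R p q; set X := pinvmp Q.
have QT := irreducible_sym hQ.
have XT : X^T = X by exact: pinvmp_sym.
have XQ : X *m Q = Q *m X by exact: pinvmp_comm.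
have /and4P[/eqP p1 _ _ _] := pinvmpP Q.
pose z := w - Q *m X *m w.
have Qz : Q *m z = 0.
  by rewrite /z mulmxBr !mulmxA -(mulmxA Q Q) -XQ mulmxA p1 subrr.
have zz : z^T *m z = 0.
  have -> : z^T = w^T - w^T *m X *m Q.
    by rewrite linearB /= !trmx_mul XT QT mulmxA.
  by rewrite mulmxBl -(mulmxA _ Q) Qz mulmx0 subr0
    (irreducible_ker_diff_vec p q hQ Qz).
have z0 : z^T = 0 by apply: dotmx_eq0; rewrite trmxK.
by apply/esym/eqP; rewrite -subr_eq0 -/z -[z]trmxK z0 trmx0.
Qed.

(** Writing [X = X Q X] turns the resistance into the quadratic form of [Q] at [X w]. *)
Lemma eff_res_ge0 n (Q : 'M[R]_n) p q : irreducible_loopy_laplacian Q ->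
  0 <= eff_res Q p q.
Proof.
move=> hQ; have XT := pinvmp_sym (irreducible_sym hQ).
have /and4P[_ /eqP p2 _ _] := pinvmpP Q.
rewrite mxE -p2 -{1}XT !mulmxA -trmx_mul -mulmxA.
exact: irreducible_psd.
Qed.

(** * Effective resistances after the perturbation *)

Section Update.
Variables (n : nat) (Q : 'M[R]_n) (p q : 'I_n) (Delta : R).
Let w := diff_vec R p q.
Let Qt := Q + Delta *: (w *m w^T).
Hypotheses (hQ : irreducible_loopy_laplacian Q)
           (hQt : irreducible_loopy_laplacian Qt).

Lemma eff_res_denom_neq0 : 1 + Delta * eff_res Q p q != 0.
Proof.
apply/eqP; rewrite mxE => s0.
have := rank1_update_mul Delta (diff_vec_range p q hQ).
rewrite s0 scale0r => /(irreducible_ker_diff_vec p q hQt).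
rewrite mulmxA => r0; move/eqP: s0.
by rewrite r0 mxE mulr0 addr0 oner_eq0.
Qed.

Lemma eff_res_denom_gt0 : 0 < 1 + Delta * eff_res Q p q.
Proof.
rewrite lt0r eff_res_denom_neq0 /=.
have XT := pinvmp_sym (irreducible_sym hQ).
have := irreducible_psd (pinvmp Q *m w) hQt.
rewrite -mulmxA rank1_update_mul ?diff_vec_range //.
rewrite trmx_mul XT -scalemxAr mxE.
have := eff_res_ge0 p q hQ; rewrite mxE -/w.
(* The form of [Qt] at [X w] equals [(1 + Delta r) r]; a nonzero [r] is positive and can be divided
   out. *)
set r := (_ *m w) 0 0; have [-> _ _|r0 r_ge0] := eqVneq r 0.
  by rewrite mulr0 addr0 ler01.
by rewrite pmulr_lge0 // lt0r r0.
Qed.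

Lemma eff_res_update k l : eff_res Qt k l = eff_res Q k l
  - Delta / (1 + Delta * eff_res Q p q)
    * l2norm ((diff_vec R k l)^T *m pinvmp Q *m w) ^+ 2.
Proof.
have QT := irreducible_sym hQ; have XT := pinvmp_sym QT.
have := eff_res_denom_neq0; rewrite ![eff_res _ _ _]mxE => s0.
rewrite pinvmp_rank1_update ?diff_vec_range //.
move: (diff_vec R k l) => u.
rewrite mulmxBr mulmxBl [LHS]mxE [X in _ + X]mxE; congr (_ - _).
rewrite -scalemxAr -scalemxAl mxE; congr (_ * _).
(* The norm is that of a 1 by 1 matrix, so its square is the square of the entry; symmetry of [X]
   identifies [w^T X u] with [u^T X w]. *)
rewrite /l2norm big_ord1 sqr_sqrtr ?sqr_ge0 // !mulmxA.
rewrite -!(mulmxA _ w^T) -(mulmxA _ (w^T *m _)) (bilin_sym _ _ XT).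
by rewrite [LHS]mxE big_ord1 expr2.
Qed.

End Update.

(** * Kron reduction after the perturbation *)

Section Kron.
Variables (a b : nat) (Q : 'M[R]_(a + b)) (i j : 'I_b) (Delta : R).
Let d := diff_vec R i j.
Let Qt := Q + perturb a i j Delta.
Hypotheses (a_gt0 : (0 < a)%N) (hQ : irreducible_loopy_laplacian Q)
           (hQt : irreducible_loopy_laplacian Qt).

Lemma diff_vec_rshift :
  diff_vec R (rshift a i) (rshift a j) = col_mx 0 d.
Proof.
apply/colP => k; rewrite !mxE; case: splitP => m km; rewrite !mxE.
  by rewrite -!val_eqE /= km !(ltn_eqF (ltn_addr _ _)) //= subrr.
by rewrite -!val_eqE /= km !eqn_add2l.
Qed.

(** Confined to the interior block, the perturbation affects the Schur complement only through the
    inverse of that block. *)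
Lemma perturb_block :
  perturb a i j Delta = block_mx 0 0 0 (Delta *: (d *m d^T)).
Proof.
rewrite /perturb diff_vec_rshift tr_col_mx mul_col_row trmx0.
by rewrite !mul0mx !mulmx0 scale_block_mx !scaler0.
Qed.

Lemma add_perturb_block : Qt = block_mx (ulsubmx Q) (ursubmx Q) (dlsubmx Q)
  (drsubmx Q + Delta *: (d *m d^T)).
Proof. by rewrite /Qt perturb_block -{1}[Q]submxK add_block_mx !addr0. Qed.

Lemma drsubmx_perturb : drsubmx Qt = drsubmx Q + Delta *: (d *m d^T).
Proof. by rewrite add_perturb_block block_mxKdr. Qed.

Lemma interior_res_ge0 : 0 <= interior_res Q i j.
Proof.
have uD := interior_unitmx a_gt0 hQ.
have DT : (drsubmx Q)^T = drsubmx Q by rewrite trmx_drsub irreducible_sym.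
(* Extended by zero to the boundary, [y] gives [Q] the quadratic form [d^T D^-1 d], with [D] the
   interior block. *)
pose y := invmx (drsubmx Q) *m d.
have := irreducible_psd (col_mx 0 y) hQ.
rewrite -{1}[Q]submxK tr_col_mx mul_row_block mul_row_col trmx0.
rewrite !mul0mx !add0r mulmx0 add0r [interior_res _ _ _]mxE /y trmx_mul trmx_inv DT.
by rewrite !mulmxA mulmxKV.
Qed.

(** Here invertibility of the perturbed interior block replaces the kernel argument: a zero
    denominator would force [D^-1 d = 0], making the denominator 1. *)
Lemma interior_res_denom_neq0 : 1 + Delta * interior_res Q i j != 0.
Proof.
have uD := interior_unitmx a_gt0 hQ.
have := interior_unitmx a_gt0 hQt; rewrite drsubmx_perturb => uDt.
have Dd : drsubmx Q *m invmx (drsubmx Q) *m d = d by rewrite mulmxV ?mul1mx.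
apply/eqP; rewrite mxE => s0; move: (rank1_update_mul Delta Dd).
rewrite s0 scale0r => /(canRL (mulKmx uDt)); rewrite mulmx0 => z0.
by move/eqP: s0; rewrite -mulmxA z0 mulmx0 mxE mulr0 addr0 oner_eq0.
Qed.

Lemma kron_red_update : kron_red Qt = kron_red Q
  + (Delta / (1 + Delta * interior_res Q i j))
    *: (accompanying_mx Q *m d *m d^T *m (accompanying_mx Q)^T).
Proof.
have uD := interior_unitmx a_gt0 hQ.
have := interior_unitmx a_gt0 hQt; rewrite drsubmx_perturb => uDt.
have QT := irreducible_sym hQ.
have DT : (drsubmx Q)^T = drsubmx Q by rewrite trmx_drsub QT.
have UT : (ursubmx Q)^T = dlsubmx Q by rewrite trmx_ursub QT.
have := interior_res_denom_neq0; rewrite mxE -/d -pinvmp_unit // => s0.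
rewrite /kron_red drsubmx_perturb -(pinvmp_unit uDt).
rewrite pinvmp_rank1_update //; last by rewrite pinvmp_unit // mulmxV ?mul1mx.
rewrite add_perturb_block block_mxKul block_mxKur block_mxKdl.
rewrite mulmxBr mulmxBl opprB addrA addrAC; congr (_ + _).
  by rewrite pinvmp_unit.
rewrite -scalemxAr -scalemxAl; congr (_ *: _).
rewrite /accompanying_mx linearN /= trmx_mul trmx_inv DT UT.
by rewrite !(mulmxN, mulNmx, opprK) -pinvmp_unit // !mulmxA.
Qed.

End Kron.

End IrreducibleLaplacian.

Theorem mainTheorem5 (R : realType) (a b : nat) (Q : 'M[R]_(a + b))
    (i j : 'I_b) (Delta : R)
    (ha : (2 <= a)%N) (hb : (a < a + b)%N)
    (hQ : irreducible_loopy_laplacian Q)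
    (hij : i != j)
    (hQt : irreducible_loopy_laplacian (Q + perturb a i j Delta)) :
  let Qt := Q + perturb a i j Delta in
  let p := rshift a i in
  let q := rshift a j in
  [/\ 0 <= interior_res Q i j,
      1 + Delta * interior_res Q i j != 0
    & kron_red Qt = kron_red Q
        + (Delta / (1 + Delta * interior_res Q i j))
          *: (accompanying_mx Q *m diff_vec R i j *m (diff_vec R i j)^T *m (accompanying_mx Q)^T)]
  /\
  [/\ 1 + Delta * eff_res Q p q != 0,
      forall k l : 'I_(a + b),
        eff_res Qt k l = eff_res Q k l
          - Delta / (1 + Delta * eff_res Q p q)
            * l2norm ((diff_vec R k l)^T *m pinvmp Q *m diff_vec R p q) ^+ 2,
      0 < Delta -> forall k l : 'I_(a + b), eff_res Qt k l <= eff_res Q k l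
    & Delta < 0 -> forall k l : 'I_(a + b), eff_res Q k l <= eff_res Qt k l].
Proof.
(* A nonempty boundary is what makes the interior blocks invertible. *)
have a0 : (0 < a)%N by exact: ltnW.
split; first by split; [exact: interior_res_ge0 | exact: interior_res_denom_neq0 |
  exact: kron_red_update].
(* With a positive denominator, the sign of [Delta] alone decides the direction of both
   inequalities. *)
have s0 := eff_res_denom_gt0 hQ hQt.
split=> [||D0 k l|D0 k l].
- exact: eff_res_denom_neq0.
- exact: eff_res_update.
- rewrite (eff_res_update hQ hQt) gerBl mulr_ge0 ?sqr_ge0 //.
  by rewrite divr_ge0 // ltW.
- rewrite (eff_res_update hQ hQt) lerDl oppr_ge0 mulr_le0_ge0 ?sqr_ge0 //.
  by rewrite pmulr_lle0 ?invr_gt0 // ltW.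
Qed.
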